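(* $\mathrm{FO}$ and $\mathrm{GRA}=\mathrm{GRA}(e,p,s,I,\neg,J,\exists)$ are equiexpressive; that is, every term of $\mathrm{GRA}(e,p,s,I,\neg,J,\exists)$ has an equivalent $\mathrm{FO}$-formula, and every $\mathrm{FO}$-formula has an equivalent term of $\mathrm{GRA}(e,p,s,I,\neg,J,\exists)$.
   Context: AD-relations. $A^0=\{\epsilon\}$, with $\epsilon$ the empty tuple. A $k$-ary AD-relation over a set $A$ is a pair $(R,k)$ with $R\subseteq A^k$, $k\ge 0$; $t\in(R,k)$ means $t\in R$. Vocabularies contain only relation symbols (of any arity $k\ge 0$, countably infinitely many available for each arity). Models have nonempty domains; $A$ is the domain of $\mathfrak{A}$. Terms. $\mathrm{GRA}(e,p,s,I,\neg,J,\exists)$ is the set of terms built from relation symbols and the constant $e$ by the unary operators $p,s,I,\neg,\exists$ and the binary operator $J$. Each term $\mathcal{T}$ defines in each model $\mathfrak{A}$ an AD-relation $\mathcal{T}^{\mathfrak{A}}$ of arity $\mathit{ar}(\mathcal{T})$. Let $k=\mathit{ar}(\mathcal{T})$, $\ell=\mathit{ar}(\mathcal{S})$. - $R^{\mathfrak{A}}$ is the interpretation of $R$, paired with the arity of $R$; $e^{\mathfrak{A}}=(\{(a,a)\mid a\in A\},2)$. - If $k\ge2$: $(p\mathcal{T})^{\mathfrak{A}}=(\{(a_k,a_1,\dots,a_{k-1})\mid(a_1,\dots,a_k)\in\mathcal{T}^{\mathfrak{A}}\},k)$; $(s\mathcal{T})^{\mathfrak{A}}=(\{(a_1,\dots,a_{k-2},a_k,a_{k-1})\mid(a_1,\dots,a_k)\in\mathcal{T}^{\mathfrak{A}}\},k)$;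 $(I\mathcal{T})^{\mathfrak{A}}=(\{(a_1,\dots,a_{k-1})\mid(a_1,\dots,a_k)\in\mathcal{T}^{\mathfrak{A}},\ a_{k-1}=a_k\},k-1)$. If $k\le1$, each of $p\mathcal{T},s\mathcal{T},I\mathcal{T}$ is interpreted as $\mathcal{T}^{\mathfrak{A}}$. - $(\neg\mathcal{T})^{\mathfrak{A}}=(\{t\in A^k\mid t\notin\mathcal{T}^{\mathfrak{A}}\},k)$. - $(J(\mathcal{T},\mathcal{S}))^{\mathfrak{A}}=(\{(a_1,\dots,a_k,b_1,\dots,b_\ell)\mid(a_1,\dots,a_k)\in\mathcal{T}^{\mathfrak{A}},(b_1,\dots,b_\ell)\in\mathcal{S}^{\mathfrak{A}}\},k+\ell)$. - If $k\ge1$: $(\exists\mathcal{T})^{\mathfrak{A}}=(\{(a_1,\dots,a_{k-1})\mid(a_1,\dots,a_k)\in\mathcal{T}^{\mathfrak{A}}\text{ for some }a_k\in A\},k-1)$; if $k=0$: $(\exists\mathcal{T})^{\mathfrak{A}}=\mathcal{T}^{\mathfrak{A}}$. Formulas. $\mathrm{FO}$ is first-order logic with equality over relation symbols, with variables $v_1,v_2,\dots$. A formula $\varphi$ whose free variables are exactly $v_{i_1},\dots,v_{i_k}$ with $i_1<\dots<i_k$ defines $\varphi^{\mathfrak{A}}=(\{(a_1,\dots,a_k)\in A^k\mid\mathfrak{A}\models\varphi(a_1,\dots,a_k)\},k)$, where $a_j$ is assigned to $v_{i_j}$. A formula $\varphi$ and a term $\mathcal{T}$ are equivalent if $\varphi^{\mathfrak{A}}=\mathcal{T}^{\mathfrak{A}}$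 for every model $\mathfrak{A}$ whose vocabulary contains all symbols of $\varphi$ and $\mathcal{T}$. *)

(* Defs.v *)
From mathcomp Require Import all_boot.
From mathcomp Require Import classical_sets.

Set Implicit Arguments.
Unset Strict Implicit.
Unset Printing Implicit Defensive.

Local Open Scope classical_set_scope.

(* Countably many symbols [Symbol k 0, Symbol k 1, ...] of each arity [k]. *)
Record symbol := Symbol { sym_arity : nat; sym_name : nat }.

Record model := Model {
  voc : set symbol;
  dom :> Type;
  dom_nonempty : inhabited dom;
  interp : forall R : symbol, voc R -> set ((sym_arity R).-tuple dom)
}.

(* AD-relations: the arity is part of the data, so that the empty relations
   of different arities are distinct. *)
Definition adrel (A : Type) : Type := {k : nat & set (k.-tuple A)}.

Definition ADrel (A : Type) (k : nat) (R : set (k.-tuple A)) : adrel A :=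
  existT (fun k => set (k.-tuple A)) k R.

Section Operators.
Variable A : Type.
Implicit Types X Y : adrel A.

Definition ad_e : adrel A :=
  ADrel [set t : 2.-tuple A | exists a, t = [tuple a; a]].

(* A tuple of length [k.+1] or [k.+2] is written [rcons u a] or
   [rcons (rcons u a) b], with [u] of length [k]. *)
Definition ad_p X : adrel A :=
  match X with
  | existT k.+2 R =>
      ADrel [set t : k.+2.-tuple A | exists (u : k.+1.-tuple A) (a : A),
               R [tuple of rcons u a] /\ t = [tuple of a :: u]]
  | _ => X
  end.

Definition ad_s X : adrel A :=
  match X with
  | existT k.+2 R =>
      ADrel [set t : k.+2.-tuple A | exists (u : k.-tuple A) (a b : A),
               R [tuple of rcons (rcons u a) b] /\
               t = [tuple of rcons (rcons u b) a]]
  | _ => X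
  end.

Definition ad_I X : adrel A :=
  match X with
  | existT k.+2 R =>
      ADrel [set t : k.+1.-tuple A | exists (u : k.-tuple A) (a : A),
               R [tuple of rcons (rcons u a) a] /\ t = [tuple of rcons u a]]
  | _ => X
  end.

Definition ad_neg X : adrel A :=
  match X with existT _ R => ADrel (~` R) end.

Definition ad_J X Y : adrel A :=
  match X, Y with
  | existT k R, existT l Q =>
      ADrel [set t : (k + l).-tuple A |
               exists (u : k.-tuple A) (v : l.-tuple A),
                 [/\ R u, Q v & t = [tuple of u ++ v]]]
  end.

Definition ad_ex X : adrel A :=
  match X with
  | existT k.+1 R =>
      ADrel [set t : k.-tuple A | exists a : A, R [tuple of rcons t a]]
  | _ => X
  end.

End Operators.

(* Outside the vocabulary the value is the empty relation; this junk value is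
   never used by [equivalent] below. *)
Definition rel_interp (M : model) (R : symbol) : set ((sym_arity R).-tuple M) :=
  [set t | exists h : voc M R, interp h t].

Inductive term : Type :=
| TRel of symbol
| Te
| Tp of term
| Ts of term
| TI of term
| Tneg of term
| TJ of term & term
| Tex of term.

Fixpoint term_symbols (T : term) : set symbol :=
  match T with
  | TRel R => [set R]
  | Te => set0
  | Tp T1 | Ts T1 | TI T1 | Tneg T1 | Tex T1 => term_symbols T1
  | TJ T1 T2 => term_symbols T1 `|` term_symbols T2
  end.

Fixpoint term_rel (M : model) (T : term) : adrel M :=
  match T with
  | TRel R => ADrel (@rel_interp M R)
  | Te => ad_e M
  | Tp T1 => ad_p (term_rel M T1)
  | Ts T1 => ad_s (term_rel M T1)
  | TI T1 => ad_I (term_rel M T1)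
  | Tneg T1 => ad_neg (term_rel M T1)
  | TJ T1 T2 => ad_J (term_rel M T1) (term_rel M T2)
  | Tex T1 => ad_ex (term_rel M T1)
  end.

(* In formulas, the natural number [i] stands for the variable
   v_(i+1). *)

Inductive formula : Type :=
| FEq of nat & nat
| FRel (R : symbol) of (sym_arity R).-tuple nat
| FNot of formula
| FAnd of formula & formula
| FOr of formula & formula
| FImp of formula & formula
| FIff of formula & formula
| FEx of nat & formula
| FAll of nat & formula.

Fixpoint formula_symbols (f : formula) : set symbol :=
  match f with
  | FEq _ _ => set0
  | FRel R _ => [set R]
  | FNot f1 | FEx _ f1 | FAll _ f1 => formula_symbols f1
  | FAnd f1 f2 | FOr f1 f2 | FImp f1 f2 | FIff f1 f2 =>
      formula_symbols f1 `|` formula_symbols f2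
  end.

Fixpoint free_occurrences (f : formula) : seq nat :=
  match f with
  | FEq x y => [:: x; y]
  | FRel _ xs => xs
  | FNot f1 => free_occurrences f1
  | FAnd f1 f2 | FOr f1 f2 | FImp f1 f2 | FIff f1 f2 =>
      free_occurrences f1 ++ free_occurrences f2
  | FEx x f1 | FAll x f1 => [seq y <- free_occurrences f1 | y != x]
  end.

Definition free_vars (f : formula) : seq nat :=
  sort leq (undup (free_occurrences f)).

Fixpoint sat (M : model) (s : nat -> M) (f : formula) : Prop :=
  match f with
  | FEq x y => s x = s y
  | FRel R xs => rel_interp (map_tuple s xs)
  | FNot f1 => ~ sat s f1
  | FAnd f1 f2 => sat s f1 /\ sat s f2
  | FOr f1 f2 => sat s f1 \/ sat s f2
  | FImp f1 f2 => sat s f1 -> sat s f2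
  | FIff f1 f2 => sat s f1 <-> sat s f2
  | FEx x f1 => exists a : M, sat [eta s with x |-> a] f1
  | FAll x f1 => forall a : M, sat [eta s with x |-> a] f1
  end.

(* The assignment [s] sends the j-th free variable to the j-th entry of [t];
   its values at the other variables do not affect [sat s f]. *)
Definition formula_rel (M : model) (f : formula) : adrel M :=
  ADrel [set t : (size (free_vars f)).-tuple M |
           exists s : nat -> M,
             t = map_tuple s (in_tuple (free_vars f)) /\ sat s f].

Definition equivalent (f : formula) (T : term) : Prop :=
  forall M : model,
    formula_symbols f `<=` voc M -> term_symbols T `<=` voc M ->
    formula_rel M f = term_rel M T.

(* Main.v *)
From mathcomp Require Import all_boot.
From mathcomp Require Import boolp classical_sets.
Require Import Defs.

(** Terms and formulas are compared through variable lists: a list [xs] of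
variables, possibly with repetitions, turns membership of the tuple
[map s xs] in a relation into a condition on the assignment [s]. Read this
way, [p] and [s] permute the list arbitrarily, [I] contracts a repeated
variable, [J] is conjunction over the concatenated list, and the projection
quantifies the last variable. From terms to formulas, the list is chosen in
advance and a fresh variable is taken at each projection, so that no
substitution in formulas is ever needed. From formulas to terms, an atom is
expressed over its own list of arguments, and contracting and permuting
normalises any list to the sorted list of free variables. *)

Set Implicit Arguments.
Unset Strict Implicit.
Unset Printing Implicit Defensive.

Local Open Scope classical_set_scope.

(** * AD-relations seen through their member lists *)

Definition ad_arity A (X : adrel A) : nat := projT1 X.

(** Plain lists keep the length out of the type, so lists can be rearranged without casts between
    tuple types. *)
Definition ad_mem A (X : adrel A) (l : seq A) : Prop :=
  exists t : (ad_arity X).-tuple A, projT2 X t /\ val t = l.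

Section AdMem.
Variable A : Type.
Implicit Types (X Y : adrel A) (l u : seq A) (a b : A).

Lemma ad_mem_size X l : ad_mem X l -> size l = ad_arity X.
Proof. by case=> t [_ <-]; rewrite size_tuple. Qed.

Lemma ad_mem_val k (R : set (k.-tuple A)) (t : k.-tuple A) :
  ad_mem (ADrel R) t <-> R t.
Proof. by split=> [[t' [Rt /val_inj <-]]|Rt] //; exists t. Qed.

(** The arities must be compared separately: empty relations of different arities have the same
    member lists, namely none. *)
Lemma adrel_ext X Y :
  ad_arity X = ad_arity Y -> (forall l, ad_mem X l <-> ad_mem Y l) -> X = Y.
Proof.
case: X Y => k R [k' Q] /= ekk'; rewrite /ad_arity /= in ekk'; subst k' => eRQ.
congr existT; apply/funext => t; apply/propext.
by rewrite -(ad_mem_val R) -(ad_mem_val Q); exact: eRQ.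
Qed.

Lemma ad_mem_e a b : ad_mem (ad_e A) [:: a; b] <-> a = b.
Proof.
split=> [[t [[c ->] [<- <-]]]|<-] //.
by exists [tuple a; a]; split=> //; exists a.
Qed.

(** No arity condition arises, because [rot 1] fixes lists of length at most one, just as [ad_p]
    fixes relations of arity at most one. *)
Lemma ad_mem_p X l : ad_mem (ad_p X) l <-> ad_mem X (rot 1 l).
Proof.
case: X => -[|[|k]] R.
1,2: by split=> Xl; have := ad_mem_size Xl; rewrite ?size_rot;
  move: Xl; case: l => [|a [|b l]].
split=> [[_ [[u [a [Ru ->]]] <-]]|[t [Rt]]].
  by rewrite /= rot1_cons; exists [tuple of rcons u a].
case: l => [|a u] et; first by have := size_tuple t; rewrite et.
have su : size u == k.+1.
  by have := size_tuple t; rewrite et size_rot /= => -[->].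
exists [tuple of a :: Tuple su]; split=> //; exists (Tuple su), a; split=> //.
by rewrite (_ : [tuple of _] = t) //; apply: val_inj; rewrite et /= rot1_cons.
Qed.

(** In arity at most one both sides fail, the lists being too long. *)
Lemma ad_mem_s X u a b :
  ad_mem (ad_s X) (rcons (rcons u a) b) <-> ad_mem X (rcons (rcons u b) a).
Proof.
case: X => -[|[|k]] R.
1,2: by split=> /ad_mem_size; rewrite !size_rcons.
split=> [[_ [[v [c [d [Rv ->]]]]]]|[t [Rt et]]].
  move=> /= /rcons_inj[/rcons_inj[<- <-] <-].
  by exists [tuple of rcons (rcons v c) d].
have su : size u == k by have := size_tuple t; rewrite et !size_rcons => -[->].
exists [tuple of rcons (rcons (Tuple su) a) b]; split=> //.
exists (Tuple su), b, a; split=> //.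
by rewrite (_ : [tuple of _] = t) //; apply: val_inj; rewrite et.
Qed.

(** In arity one [ad_I] is the identity and the equivalence can fail for empty [u], hence the
    bound. *)
Lemma ad_mem_I X u a : 1 < ad_arity X ->
  ad_mem (ad_I X) (rcons u a) <-> ad_mem X (rcons (rcons u a) a).
Proof.
case: X => -[|[|k]] R // _.
split=> [[_ [[v [c [Rv ->]]]]]|[t [Rt et]]].
  by move=> /= /rcons_inj[<- <-]; exists [tuple of rcons (rcons v c) c].
have su : size u == k by have := size_tuple t; rewrite et !size_rcons => -[->].
exists [tuple of rcons (Tuple su) a]; split=> //.
exists (Tuple su), a; split=> //.
by rewrite (_ : [tuple of _] = t) //; apply: val_inj; rewrite et.
Qed.

Lemma ad_mem_neg X l :
  size l = ad_arity X -> ad_mem (ad_neg X) l <-> ~ ad_mem X l.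
Proof.
case: X => k R /eqP sl.
by rewrite (ad_mem_val (~` R) (Tuple sl)) (ad_mem_val R (Tuple sl)).
Qed.

Lemma ad_mem_J X Y l l' : size l = ad_arity X ->
  ad_mem (ad_J X Y) (l ++ l') <-> ad_mem X l /\ ad_mem Y l'.
Proof.
case: X Y => k R [k' Q] sl; split.
  case=> _ [[v [w [Rv Qw ->]]] /= evw].
  have := congr1 (take k) evw; have := congr1 (drop k) evw.
  rewrite !drop_size_cat ?take_size_cat ?size_tuple // => <- <-.
  by split; [exists v | exists w].
case=> -[v [Rv <-]] [w [Qw <-]]; exists [tuple of v ++ w]; split=> //.
by exists v, w.
Qed.

Lemma ad_mem_ex X l : 0 < ad_arity X ->
  ad_mem (ad_ex X) l <-> exists a, ad_mem X (rcons l a).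
Proof.
case: X => -[|k] R // _; split.
  by case=> t [[a Ra] <-]; exists a, [tuple of rcons t a].
case=> a [t [Rt et]].
have sl : size l == k by have := size_tuple t; rewrite et size_rcons => -[->].
exists (Tuple sl); split=> //; exists a.
by rewrite (_ : [tuple of _] = t) //; apply: val_inj; rewrite et.
Qed.

Lemma ad_arity_p X : ad_arity (ad_p X) = ad_arity X.
Proof. by case: X => -[|[|k]]. Qed.

Lemma ad_arity_s X : ad_arity (ad_s X) = ad_arity X.
Proof. by case: X => -[|[|k]]. Qed.

Lemma ad_arity_neg X : ad_arity (ad_neg X) = ad_arity X.
Proof. by case: X. Qed.

Lemma ad_arity_J X Y : ad_arity (ad_J X Y) = ad_arity X + ad_arity Y.
Proof. by case: X; case: Y. Qed.

Lemma ad_arity_ex X : ad_arity (ad_ex X) = (ad_arity X).-1.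
Proof. by case: X => -[|k]. Qed.

Lemma ad_arity_I X :
  ad_arity (ad_I X) = if 1 < ad_arity X then (ad_arity X).-1 else ad_arity X.
Proof. by case: X => -[|[|k]]. Qed.

Lemma ad_I_small X : ad_arity X <= 1 -> ad_I X = X.
Proof. by case: X => -[|[|k]]. Qed.

Lemma ad_s_small X : ad_arity X <= 1 -> ad_s X = X.
Proof. by case: X => -[|[|k]]. Qed.

Lemma ad_ex_small X : ad_arity X = 0 -> ad_ex X = X.
Proof. by case: X => -[|k]. Qed.

End AdMem.

(** * Terms as conditions on assignments *)

Definition expresses (T : term) (xs : seq nat)
    (P : forall M : model, (nat -> M) -> Prop) : Prop :=
  forall M : model, ad_arity (term_rel M T) = size xs /\
    forall s : nat -> M, ad_mem (term_rel M T) (map s xs) <-> P M s.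

Lemma map_surj (A : Type) (xs : seq nat) (l : seq A) :
  inhabited A -> uniq xs -> size l = size xs ->
  exists s : nat -> A, l = map s xs.
Proof.
(* Variables outside [xs] have index [size xs], which equals [size l], so [nth] returns the default
   [a0]. *)
case=> a0 uxs sl; exists (fun x => nth a0 l (index x xs)).
apply: (@eq_from_nth _ a0); rewrite ?size_map // => i; rewrite sl => ltix.
by rewrite (nth_map 0) // index_uniq.
Qed.

(** The free variables are listed without repetition, so every tuple of the right length comes from
    an assignment. *)
Lemma equivalent_of_expresses (f : formula) (T : term) :
  expresses T (free_vars f) (fun M s => sat s f) -> equivalent f T.
Proof.
move=> Tf M _ _; have [arT memT] := Tf M.
apply: adrel_ext => [|l]; first by rewrite arT.
split=> [[t [[s [-> sf]] <-]]|Tl]; first exact/memT.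
have [s el] : exists s : nat -> M, l = map s (free_vars f).
  apply: map_surj; first exact: dom_nonempty.
    by rewrite sort_uniq undup_uniq.
  by rewrite (ad_mem_size Tl).
rewrite el in Tl *; exists (map_tuple s (in_tuple (free_vars f))).
by split=> //; exists s; split=> //; apply/memT.
Qed.

Lemma map_update (A : Type) (s : nat -> A) (x : nat) (a : A) (xs : seq nat) :
  x \notin xs -> map [eta s with x |-> a] xs = map s xs.
Proof.
by move=> xNxs; apply/eq_in_map => y /= yxs; case: eqP yxs xNxs => // -> ->.
Qed.

(** * From terms to formulas *)

Fixpoint term_arity (T : term) : nat :=
  match T with
  | TRel R => sym_arity R
  | Te => 2
  | Tp T1 | Ts T1 | Tneg T1 => term_arity T1
  | TI T1 => if 1 < term_arity T1 then (term_arity T1).-1 else term_arity T1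
  | TJ T1 T2 => term_arity T1 + term_arity T2
  | Tex T1 => (term_arity T1).-1
  end.

Lemma ad_arity_term (M : model) (T : term) :
  ad_arity (term_rel M T) = term_arity T.
Proof.
elim: T => //= [T <-|T <-|T <-|T <-|T <- T' <-|T <-].
- exact: ad_arity_p.
- exact: ad_arity_s.
- exact: ad_arity_I.
- exact: ad_arity_neg.
- exact: ad_arity_J.
- exact: ad_arity_ex.
Qed.

Lemma exists_fresh (xs : seq nat) : exists y, y \notin xs.
Proof.
exists (\max_(x <- xs) x).+1; apply/negP => yxs.
by have := @leq_bigmax_seq _ xs xpredT id _ yxs isT; rewrite ltnn.
Qed.

(** The list stays arbitrary, repetitions included, since most operators call the induction
    hypothesis on a modified list. The bound on free variables later lets padding make them exactly
    the chosen list. *)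
Lemma formula_of_term (T : term) (xs : seq nat) : size xs = term_arity T ->
  exists f : formula, {subset free_occurrences f <= xs} /\
    expresses T xs (fun M s => sat s f).
Proof.
suff H : size xs = term_arity T -> exists f : formula,
    {subset free_occurrences f <= xs} /\ forall (M : model) (s : nat -> M),
    ad_mem (term_rel M T) (map s xs) <-> sat s f.
  move=> sxs; have [f [fxs Tf]] := H sxs; exists f; split=> // M.
  by rewrite ad_arity_term.
elim: T xs => [R||T IH|T IH|T IH|T IH|T1 IH1 T2 IH2|T IH] xs /= sxs.
- have /eqP txs := sxs; exists (FRel (Tuple txs)); split=> // M s.
  exact: (ad_mem_val (@rel_interp M R) (map_tuple s (Tuple txs))).
- case: xs sxs => [|x [|y []]] // _; exists (FEq x y); split=> // M s.
  exact: ad_mem_e.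
- have [|f [fxs Tf]] := IH (rot 1 xs); first by rewrite size_rot.
  exists f; split=> [x /fxs|M s]; first by rewrite mem_rot.
  by rewrite ad_mem_p -map_rot Tf.
- have [le1|gt1] := leqP (term_arity T) 1.
    have [f [fxs Tf]] := IH xs sxs; exists f; split=> // M s.
    by rewrite ad_s_small ?ad_arity_term.
  case/lastP: xs sxs => [|xs y] sxs; first by rewrite -sxs in gt1.
  case/lastP: xs sxs => [|xs x] sxs; first by rewrite -sxs in gt1.
  have [|f [fxs Tf]] := IH (rcons (rcons xs y) x).
    by rewrite -sxs !size_rcons.
  exists f; split=> [z /fxs|M s]; first by rewrite !(mem_rcons, inE) orbCA.
  by rewrite !map_rcons ad_mem_s -Tf !map_rcons.
- case: ifP sxs => [gt1|ngt1] sxs; last first.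
    have le1 : term_arity T <= 1 by rewrite leqNgt ngt1.
    have [f [fxs Tf]] := IH xs sxs; exists f; split=> // M s.
    by rewrite ad_I_small ?ad_arity_term.
  case/lastP: xs sxs => [|xs x] sxs; first by case: term_arity gt1 sxs => [|[]].
  (* Repeating [x] in the list forces the last two coordinates to agree without any equality
     atom. *)
  have [|f [fxs Tf]] := IH (rcons (rcons xs x) x).
    by rewrite size_rcons sxs prednK // ltnW.
  exists f; split=> [z /fxs|M s]; first by rewrite !(mem_rcons, inE) orbA orbb.
  by rewrite !map_rcons ad_mem_I ?ad_arity_term // -Tf !map_rcons.
- have [f [fxs Tf]] := IH xs sxs; exists (FNot f); split=> // M s.
  by rewrite ad_mem_neg ?ad_arity_term ?size_map // Tf.
- have s1 : size (take (term_arity T1) xs) = term_arity T1.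
    by rewrite size_takel // sxs leq_addr.
  have [f1 [f1xs Tf1]] := IH1 _ s1.
  have [|f2 [f2xs Tf2]] := IH2 (drop (term_arity T1) xs).
    by rewrite size_drop sxs addKn.
  exists (FAnd f1 f2); split=> [x|M s].
    by rewrite mem_cat => /orP[/f1xs /mem_take|/f2xs /mem_drop].
  rewrite -{1}(cat_take_drop (term_arity T1) xs) map_cat.
  by rewrite ad_mem_J ?ad_arity_term ?size_map // Tf1 Tf2.
- have [ar0|ar_gt0] := posnP (term_arity T).
    have [|f [fxs Tf]] := IH xs; first by rewrite sxs ar0.
    by exists f; split=> // M s; rewrite ad_ex_small ?ad_arity_term.
  (* Freshness ensures that rebinding [y] leaves the values along [xs] unchanged. *)
  have [y yNxs] := exists_fresh xs.
  have [|f [fxs Tf]] := IH (rcons xs y).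
    by rewrite size_rcons sxs prednK.
  exists (FEx y f); split=> [x|M s] /=.
    rewrite mem_filter => /andP[xNy /fxs].
    by rewrite mem_rcons inE (negbTE xNy).
  rewrite ad_mem_ex ?ad_arity_term //.
  have eq a : rcons (map s xs) a = map [eta s with y |-> a] (rcons xs y).
    by rewrite map_rcons map_update //= eqxx.
  by split=> -[a fa]; exists a; move: fa; rewrite eq Tf.
Qed.

(* The conjuncts [x = x] make every [x] in [xs] free. *)
Definition pad (xs : seq nat) (f : formula) : formula :=
  foldr (fun x g => FAnd (FEq x x) g) f xs.

Lemma mem_free_pad xs f :
  free_occurrences (pad xs f) =i xs ++ free_occurrences f.
Proof.
elim: xs => //= x xs IH y; rewrite !inE IH.
by rewrite orbA orbb.
Qed.

Lemma sat_pad xs f (M : model) (s : nat -> M) : sat s (pad xs f) <-> sat s f.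
Proof. by elim: xs => //= x xs IH; rewrite IH; split=> [[]|]. Qed.

Lemma free_vars_pad n f : {subset free_occurrences f <= iota 0 n} ->
  free_vars (pad (iota 0 n) f) = iota 0 n.
Proof.
move=> fn; apply: (sorted_eq leq_trans anti_leq).
- exact/sort_sorted/leq_total.
- exact: iota_sorted.
rewrite perm_sort; apply: uniq_perm => [||x]; rewrite ?undup_uniq ?iota_uniq //.
rewrite mem_undup mem_free_pad mem_cat.
by apply/orP/idP => [[//|/fn]|] //; left.
Qed.

(** * From formulas to terms *)

Definition expressible (xs : seq nat)
    (P : forall M : model, (nat -> M) -> Prop) : Prop :=
  exists T : term, expresses T xs P.

Section Expressible.
Implicit Types (xs ys zs : seq nat) (x y : nat).
Implicit Types P Q : forall M : model, (nat -> M) -> Prop.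

Lemma expressible_ext xs P Q :
  (forall M s, P M s <-> Q M s) -> expressible xs P -> expressible xs Q.
Proof.
move=> PQ [T TP]; exists T => M; have [? TPM] := TP M; split=> // s.
by rewrite TPM.
Qed.

Lemma expressible_rotr1 xs x P :
  expressible (rcons xs x) P -> expressible (x :: xs) P.
Proof.
case=> T TP; exists (Tp T) => M; have [arT TPM] := TP M; split=> [|s] /=.
  by rewrite ad_arity_p arT size_rcons.
by rewrite ad_mem_p rot1_cons -map_rcons.
Qed.

Lemma expressible_swap_last xs x y P :
  expressible (rcons (rcons xs x) y) P -> expressible (rcons (rcons xs y) x) P.
Proof.
case=> T TP; exists (Ts T) => M; have [arT TPM] := TP M; split=> [|s] /=.
  by rewrite ad_arity_s arT !size_rcons.
by rewrite !map_rcons ad_mem_s -!map_rcons.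
Qed.

(** By iterating [Tp], the elements of [ys], last one first, move in front of [xs]. *)
Lemma expressible_catC xs ys P :
  expressible (xs ++ ys) P -> expressible (ys ++ xs) P.
Proof.
elim/last_ind: ys xs => [|ys y IH] xs; first by rewrite cats0.
rewrite -rcons_cat => /expressible_rotr1; rewrite -cat_cons => /IH.
by rewrite cat_rcons.
Qed.

(** Conjugation: a cyclic shift brings the pair to the end, [Ts] swaps it there, and another shift
    brings it back. *)
Lemma expressible_swap xs x y ys P :
  expressible (xs ++ x :: y :: ys) P -> expressible (xs ++ y :: x :: ys) P.
Proof.
rewrite -2!cat_rcons => /expressible_catC; rewrite -!rcons_cat.
move=> /expressible_swap_last; rewrite !rcons_cat => /expressible_catC.
by rewrite !cat_rcons.
Qed.

(** Adjacent transpositions generate all permutations. *)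
Lemma expressible_perm xs ys P :
  perm_eq xs ys -> expressible xs P -> expressible ys P.
Proof.
have move_elt ws us y vs : expressible (ws ++ us ++ y :: vs) P ->
    expressible (ws ++ y :: us ++ vs) P.
  elim/last_ind: us vs => [|us u IH] vs //=.
  by rewrite !cat_rcons catA => /expressible_swap; rewrite -catA => /IH.
(* It suffices to exchange two leading blocks. The elements of the second block cross the first one
   by one, and [ws] collects those already moved. *)
move: xs ys; apply: (@catCA_perm_ind _ (expressible^~ P)) => xs ys zs.
rewrite -[xs ++ ys ++ _]cat0s -[ys ++ xs ++ _]cat0s.
elim: ys [::] => [|y ys IH] ws //=.
by move=> /move_elt; rewrite -!cat_rcons => /IH.
Qed.

Lemma expressible_contract xs x P :
  expressible (rcons (rcons xs x) x) P -> expressible (rcons xs x) P.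
Proof.
case=> T TP; exists (TI T) => M; have [arT TPM] := TP M; split=> [|s] /=.
  by rewrite ad_arity_I arT !size_rcons.
by rewrite map_rcons ad_mem_I ?arT ?size_rcons // -!map_rcons.
Qed.

(** When [x] occurs again later, two copies are permuted to the end and contracted into one. The
    prefix [us] holds what has been processed. *)
Lemma expressible_undup xs P : expressible xs P -> expressible (undup xs) P.
Proof.
suff H us : expressible (us ++ xs) P -> expressible (us ++ undup xs) P.
  exact: (H [::]).
elim: xs us => [|x xs IH] us //=; case: ifP => [xxs|_]; last first.
  by rewrite -!cat_rcons => /IH.
move=> uxP; apply: IH; move: uxP.
have ex : perm_eq (rem x xs ++ [:: x]) xs.
  by rewrite perm_catC perm_sym perm_to_rem.
set ys := rem x xs in ex.
have exx : perm_eq (us ++ x :: xs) (rcons (rcons (us ++ ys) x) x).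
  by rewrite -!cats1 -!catA perm_cat2l perm_sym perm_catCA perm_cons.
move=> /(expressible_perm exx) /expressible_contract; apply: expressible_perm.
by rewrite -cats1 -catA perm_cat2l.
Qed.

(** This lets later constructions use any convenient list and control only its set of variables. *)
Lemma expressible_normal xs ys P :
  uniq ys -> xs =i ys -> expressible xs P -> expressible ys P.
Proof.
move=> uys exy /expressible_undup; apply: expressible_perm.
by apply: uniq_perm; rewrite ?undup_uniq // => x; rewrite mem_undup.
Qed.

Lemma expressible_not xs P :
  expressible xs P -> expressible xs (fun M s => ~ P M s).
Proof.
case=> T TP; exists (Tneg T) => M; have [arT TPM] := TP M; split=> [|s] /=.
  by rewrite ad_arity_neg.
by rewrite ad_mem_neg ?size_map // TPM.
Qed.

Lemma expressible_and xs ys P Q : expressible xs P -> expressible ys Q ->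
  expressible (xs ++ ys) (fun M s => P M s /\ Q M s).
Proof.
case=> T TP [S SQ]; exists (TJ T S) => M.
have [arT TPM] := TP M; have [arS SQM] := SQ M; split=> [|s] /=.
  by rewrite ad_arity_J arT arS size_cat.
by rewrite map_cat ad_mem_J ?size_map // TPM SQM.
Qed.

Lemma expressible_eq x y : expressible [:: x; y] (fun M s => s x = s y).
Proof. by exists Te => M; split=> // s; exact: ad_mem_e. Qed.

Lemma expressible_ex_last xs x P : x \notin xs -> expressible (rcons xs x) P ->
  expressible xs (fun M s => exists a : M, P M [eta s with x |-> a]).
Proof.
move=> xNxs [T TP]; exists (Tex T) => M; have [arT TPM] := TP M.
split=> [|s] /=; first by rewrite ad_arity_ex arT size_rcons.
have eq a : rcons (map s xs) a = map [eta s with x |-> a] (rcons xs x).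
  by rewrite map_rcons map_update //= eqxx.
rewrite ad_mem_ex ?arT ?size_rcons //.
by split=> -[a Pa]; exists a; move: Pa; rewrite eq TPM.
Qed.

(* [x] need not occur in [xs]: adding the conjunct [x = x] makes it occur. *)
Lemma expressible_ex xs x P : expressible xs P ->
  expressible [seq y <- undup xs | y != x]
    (fun M s => exists a : M, P M [eta s with x |-> a]).
Proof.
move=> xsP; apply: expressible_ex_last.
  by rewrite mem_filter eqxx.
have := expressible_and xsP (expressible_eq x x).
have PE M s : P M s /\ s x = s x <-> P M s by split=> [[]|].
move=> /(expressible_ext PE); apply: expressible_normal => [|y].
  by rewrite rcons_uniq mem_filter eqxx filter_uniq // undup_uniq.
rewrite mem_rcons mem_cat !inE mem_filter mem_undup orbb.
by have [->|_] := eqVneq y x; rewrite ?orbT // orbF.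
Qed.

End Expressible.

Lemma expressible_sat (f : formula) :
  expressible (undup (free_occurrences f)) (fun M s => sat s f).
Proof.
(* Leaving order and repetitions free in the inductive claim lets connectives simply concatenate
   lists. *)
suff [xs exs xsf] : exists2 xs, xs =i free_occurrences f &
    expressible xs (fun M s => sat s f).
  by apply: expressible_normal xsf => [|x]; rewrite ?undup_uniq ?mem_undup.
elim: f => [x y|R xs|f [xs exs xsf]|f [xs exs xsf] g [ys eys ysg]
  |f [xs exs xsf] g [ys eys ysg]|f [xs exs xsf] g [ys eys ysg]
  |f [xs exs xsf] g [ys eys ysg]|x f [xs exs xsf]|x f [xs exs xsf]] /=.
- by exists [:: x; y] => //; exact: expressible_eq.
- exists xs => //; exists (TRel R) => M.
  split=> [|s]; first by rewrite size_tuple.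
  exact: (ad_mem_val (@rel_interp M R) (map_tuple s xs)).
- by exists xs => //; exact: expressible_not.
- exists (xs ++ ys); last exact: expressible_and.
  by move=> z; rewrite !mem_cat exs eys.
- exists (xs ++ ys); first by move=> z; rewrite !mem_cat exs eys.
  (* De Morgan reduces disjunction to negation and conjunction, by excluded middle. *)
  have := expressible_and (expressible_not xsf) (expressible_not ysg).
  by move=> /expressible_not; apply: expressible_ext => M s;
     have := EM (sat s f); have := EM (sat s g); tauto.
- exists (xs ++ ys); first by move=> z; rewrite !mem_cat exs eys.
  have := expressible_and xsf (expressible_not ysg).
  by move=> /expressible_not; apply: expressible_ext => M s;
     have := EM (sat s f); have := EM (sat s g); tauto.
(* The biconditional excludes [f] without [g] and [g] without [f], so each list enters twice. *)
- exists ((xs ++ ys) ++ (ys ++ xs)).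
    by move=> z; rewrite !mem_cat exs eys; do 2!case: (z \in _).
  have := expressible_and
    (expressible_not (expressible_and xsf (expressible_not ysg)))
    (expressible_not (expressible_and ysg (expressible_not xsf))).
  by apply: expressible_ext => M s;
     have := EM (sat s f); have := EM (sat s g); tauto.
- exists [seq y <- undup xs | y != x]; last exact: (expressible_ex x xsf).
  by move=> z; rewrite !mem_filter mem_undup exs.
- exists [seq y <- undup xs | y != x].
    by move=> z; rewrite !mem_filter mem_undup exs.
  have := expressible_not (expressible_ex x (expressible_not xsf)).
  apply: expressible_ext => M s; split=> [nex a|fa [a]]; last exact.
  by apply: contrapT => nfa; apply: nex; exists a.
Qed.

Theorem theorem3p1 :
  (forall T : term, exists f : formula, equivalent f T) /\
  (forall f : formula, exists T : term, equivalent f T).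
Proof.
split=> [T|f].
(* The list [iota 0 n] is increasing, so after padding it is exactly the sorted list of free
   variables, in the order of the coordinates. *)
- have [|f [fn Tf]] := @formula_of_term T (iota 0 (term_arity T)).
    by rewrite size_iota.
  exists (pad (iota 0 (term_arity T)) f); apply: equivalent_of_expresses => M.
  have [arT TfM] := Tf M; rewrite free_vars_pad //; split=> // s.
  by rewrite TfM sat_pad.
- have [T Tf] : expressible (free_vars f) (fun M s => sat s f).
    apply: expressible_perm (expressible_sat f).
    by rewrite perm_sym perm_sort.
  by exists T; exact: equivalent_of_expresses.
Qed.
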